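(* Let $n\ge 2$ be an integer and let $\mathcal F$ be a family of subsets of $[m]=\{1,\dots,m\}$ with $\mathrm{cd}^n(\mathcal F)\ge 2n-1$. Then for every map $c\colon\mathcal F\to\mathbb{Z}/n$ there exist pairwise disjoint $A_1,\dots,A_n\in\mathcal F$ with $\sum_{i=1}^n c(A_i)=0$ in $\mathbb{Z}/n$ (i.e., every $\mathbb{Z}/n$-coloring of $\mathrm{KG}^n(\mathcal F)$ has a zero-sum hyperedge).
   Context: The $n$-uniform Kneser hypergraph $\mathrm{KG}^n(\mathcal F)$ has vertex set $\mathcal F$, and $A_1,\dots,A_n\in\mathcal F$ form a hyperedge if they are pairwise disjoint. The $n$-colorability defect is $\mathrm{cd}^n(\mathcal F)=m-\max\{\sum_{i=1}^n|A_i| : A_1,\dots,A_n\subseteq[m] \text{ pairwise disjoint, and } F\not\subseteq A_i \text{ for all } F\in\mathcal F,\ i\in[n]\}$. A $\mathbb{Z}/n$-coloring is a map from the vertex set to $\mathbb{Z}/n$; a hyperedge is zero-sum if the colors of its vertices sum to $0$. *)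

(* Defs.v *)
From mathcomp Require Import all_boot all_order all_algebra.

Set Implicit Arguments.
Unset Strict Implicit.
Unset Printing Implicit Defensive.

(* The ground set [m] is rendered as 'I_m = {0, ..., m-1}. *)

Definition pairwise_disjoint (m n : nat) (A : 'I_n -> {set 'I_m}) : bool :=
  [forall i : 'I_n, forall j : 'I_n, (i != j) ==> [disjoint A i & A j]].

Definition kneser_vertex (m : nat) (F : {set {set 'I_m}}) : Type :=
  {X : {set 'I_m} | X \in F}.

(* Hyperedges are indexed families (A_1, ..., A_n); disjointness forces the
   A_i to be distinct, except that the empty set, if it is in F, may repeat. *)
Definition kneser_hyperedge (m n : nat) (F : {set {set 'I_m}})
    (A : 'I_n -> kneser_vertex F) : bool :=
  pairwise_disjoint (fun i => sval (A i)).

(* If set0 \in F there is no admissible A, and the maximum is 0 by convention.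
   The subtraction never truncates: pairwise disjoint subsets of 'I_m have
   total size at most m. *)
Definition cd (n m : nat) (F : {set {set 'I_m}}) : nat :=
  m - \max_(A : {ffun 'I_n -> {set 'I_m}}
              | pairwise_disjoint A &&
                [forall i : 'I_n, forall X in F, ~~ (X \subset A i)])
        \sum_(i < n) #|A i|.

(* Main.v *)
Require Import Defs.
From mathcomp Require Import all_boot all_order all_algebra.
From mathcomp Require Import zify ring.

(* The property for n = pq follows from those for p and q, applied to the family
   of sets of p-defect at least 2p - 1, so let n = p be prime.  A partial map X
   from the ground set to Z/p is a p-tuple of disjoint sets; let S_i be the set
   of colours of the members of F inside the i-th one.  If no hyperedge is
   zero-sum, Cauchy-Davenport gives sum |S_i| <= 2p - 2 when all the S_i are
   nonempty.  Hence a rank with fewer than m values can be defined,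
   nondecreasing in X: the size of the domain of X when all the S_i are empty,
   which the defect bounds by m - (2p - 1), then the number of nonempty S_i, then
   sum |S_i|.  Along a chain of constant rank a suitable Z/p-equivariant label is
   constant, so no chain of m partial maps has distinct consecutive labels.  A Z/p-analogue of Ky Fan's
   lemma says that such a chain exists: the class of Z/p in degree m - 1, read
   off the labels, takes the value 1 on an explicit (m - 1)-chain h_(m-1) of
   chains of partial maps, but vanishes on sequences with two equal neighbours. *)

Set Implicit Arguments.
Unset Strict Implicit.
Unset Printing Implicit Defensive.

Import GRing.Theory.
Local Open Scope ring_scope.

(** * Cochains on sequences *)

Section Cochains.

Variables (R : comNzRingType) (T : Type).
Implicit Types (u v : seq T -> R) (s t : seq T) (f : T -> T).

(** The augmented simplicial coboundary: the alternating sum of the values of [u] on [s] with one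
    entry deleted. *)
Fixpoint delta u s : R :=
  if s is x :: s' then u s' - delta (fun t => u (x :: t)) s' else 0.

Lemma eq_delta u v s :
  (forall t, (size t).+1 = size s -> u t = v t) -> delta u s = delta v s.
Proof.
elim: s u v => [|x s IHs] u v uv //=; rewrite uv //; congr (_ - _).
by apply: IHs => t size_t; rewrite uv //= size_t.
Qed.

Lemma deltaB u v s : delta (fun t => u t - v t) s = delta u s - delta v s.
Proof. by elim: s u v => [|x s IHs] u v /=; rewrite ?IHs; ring. Qed.

Lemma delta_sum (I : Type) (r : seq I) (u : I -> seq T -> R) s :
  delta (fun t => \sum_(i <- r) u i t) s = \sum_(i <- r) delta (u i) s.
Proof.
elim: s u => [|x s IHs] u /=; first by rewrite big1.
by rewrite (IHs (fun i t => u i (x :: t))) -sumrB.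
Qed.

Lemma delta_delta u s : delta (delta u) s = 0.
Proof.
elim: s u => [|x s IHs] u //=.
by rewrite deltaB IHs; ring.
Qed.

(* Leibniz rule for the cup product with a 0-cochain, or, below, a 1-cochain. *)
Lemma delta_cup0 (z : T -> R) u x y s :
  delta (fun t => if t is y' :: _ then z y' * u t else 0) [:: x, y & s] =
  (z y - z x) * u (y :: s) + z x * delta u [:: x, y & s].
Proof.
have deltaZ c (v : seq T -> R) t : delta (fun t => c * v t) t = c * delta v t.
  by elim: t v => [|a t IHt] v /=; rewrite ?IHt; ring.
by rewrite /= deltaZ; ring.
Qed.

Lemma delta_cup1 (w : T -> T -> R) u x y z s :
  delta (fun t => if t is x' :: (y' :: _) as t' then w x' y' * u t' else 0)
    [:: x, y, z & s] =
  (w x y + w y z - w x z) * u (z :: s) - w x y * delta u [:: y, z & s].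
Proof.
have cup0 := delta_cup0 (w x) u y z s.
by move: cup0; rewrite /= => ->; ring.
Qed.

(** Dual of the prism operator for a homotopy from the identity to [f]: the alternating sum of [u]
    over the sequences [x_0, ..., x_i, f x_i, ..., f x_n]. *)
Fixpoint prism f u s : R :=
  if s is x :: s' then
    u [:: x, f x & map f s'] - prism f (fun t => u (x :: t)) s'
  else 0.

Lemma prismB f u v s : prism f (fun t => u t - v t) s = prism f u s - prism f v s.
Proof. by elim: s u v => [|x s IHs] u v /=; rewrite ?IHs; ring. Qed.

Lemma eq_prism f u v s :
    (forall s1 x s2, s = s1 ++ x :: s2 ->
      u (s1 ++ [:: x, f x & map f s2]) = v (s1 ++ [:: x, f x & map f s2])) ->
  prism f u s = prism f v s.
Proof.
elim: s u v => [|x s IHs] u v uv //=.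
rewrite (uv [::] x s) //; congr (_ - _).
by apply: IHs => s1 y s2 def_s; apply: (uv (x :: s1)); rewrite def_s.
Qed.

End Cochains.

Lemma delta_map (R : comNzRingType) (T S : Type) (f : T -> S) (u : seq S -> R) s :
  delta (fun t => u (map f t)) s = delta u (map f s).
Proof. by elim: s u => [|x s IHs] u //=; rewrite (IHs (fun t => u (f x :: t))). Qed.

Lemma prism_homotopy (R : comNzRingType) (T : Type) (f : T -> T)
    (u : seq T -> R) s :
  prism f (delta u) s + delta (prism f u) s = u (map f s) - u s.
Proof.
elim: s u => [|x s IHs] u /=; first by rewrite addr0 subrr.
rewrite prismB deltaB.
rewrite (delta_map f (fun t => u [:: x, f x & t])).
by have /(canRL (addrK _)) -> := IHs (fun t => u (x :: t)); ring.
Qed.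

(* Dual of the contraction of a chain to [v] along [id <= f >= v]. *)
Definition contraction (R : comNzRingType) (T : Type) (v : T) (f : T -> T)
  (u : seq T -> R) s : R := u (v :: map f s) - prism f u s.

(** The cone over [map f s] contributes [u (map f s)], which the prism exchanges for [u s]. *)
Lemma contraction_homotopy (R : comNzRingType) (T : Type) (v : T) (f : T -> T)
    (u : seq T -> R) s :
  contraction v f (delta u) s = u s - delta (contraction v f u) s.
Proof.
rewrite /contraction deltaB (delta_map f (fun t => u (v :: t))) /=.
by have /(canRL (addrK _)) -> := prism_homotopy f u s; ring.
Qed.

(** * Cocycles and transgressions for the cyclic group of order k + 2 *)

Section CyclicCochains.

Variable k : nat.
Local Notation Z := 'I_k.+2.
Implicit Types (x y z : Z) (s t : seq Z) (j n : nat).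

Definition succZ x : Z := x + 1.

(** For representatives between 0 and [k + 1], the residue of [y - x] is the integer
    [y - x + (k + 2) * wrap x y]. Thus [carry x y z] is the carry in adding the residues of [y - x]
    and [z - y]. *)
Definition wrap x y : Z := (y < x)%N%:R.

Definition carry x y z : Z := wrap x y + wrap y z - wrap x z.

(* The even classes are cup powers of the Bockstein class [carry]. *)
Fixpoint even_class j s : Z :=
  if j is j'.+1 then
    if s is [:: x, y & (z :: _) as t] then carry x y z * even_class j' t else 0
  else 1.

Definition odd_class j s : Z :=
  if s is x :: (y :: _) as t then (y - x) * even_class j t else 0.

Definition cyc_class n : seq Z -> Z :=
  if odd n then odd_class n./2 else even_class n./2.

Definition even_transgression j s : Z :=
  if s is x :: _ then x * even_class j s else 0.

Definition odd_transgression j s : Z :=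
  if s is x :: (y :: _) as t then wrap x y * even_class j t else 0.

(** Links consecutive degrees: the coboundary of [transgression n] is [cyc_class n.+1], while its
    difference under the shift ([n] even) or its sum over the shifts ([n] odd) is [cyc_class n]. *)
Definition transgression n : seq Z -> Z :=
  if odd n then odd_transgression n./2 else even_transgression n./2.

Lemma val_succZ x : succZ x = (if x == k.+1 :> nat then 0 else x.+1) :> nat.
Proof.
have -> : (succZ x = x.+1 %% k.+2 :> nat)%N by rewrite /= modnDmr addn1.
have := ltn_ord x.
case: eqP => [-> _|/eqP xk xlt]; first by rewrite modnn.
by rewrite modn_small // ltn_neqAle eqSS xk.
Qed.

(** The shift lowers only the largest residue, so [wrap] changes by the coboundary of an indicator
    function; [carry], the coboundary of [wrap], is therefore invariant. *)
Lemma wrap_succ x y :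
  wrap (succZ x) (succZ y) =
  wrap x y + (y == k.+1 :> nat)%:R - (x == k.+1 :> nat)%:R.
Proof.
rewrite /wrap !val_succZ; have := ltn_ord x; have := ltn_ord y.
case: eqP => [->|y_n]; case: eqP => [->|x_n] ylt xlt; rewrite ?ltnn ?ltn0 ?ltnS.
- ring.
- have -> : (k.+1 < x)%N = false by lia.
  ring.
- have -> : (y <= k)%N by lia.
  ring.
- ring.
Qed.

Lemma carry_succ x y z : carry (succZ x) (succZ y) (succZ z) = carry x y z.
Proof. by rewrite /carry !wrap_succ; ring. Qed.

Lemma even_class_succ j s : even_class j (map succZ s) = even_class j s.
Proof.
elim: j s => [|j IHj] [|x [|y [|z s]]] //=.
by rewrite carry_succ (IHj (z :: s)).
Qed.

Lemma even_classSE j x y z s :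
  even_class j.+1 [:: x, y, z & s] =
  delta (odd_transgression j) [:: x, y, z & s] +
  wrap x y * delta (even_class j) [:: y, z & s].
Proof.
have -> : delta (odd_transgression j) [:: x, y, z & s] = _ :=
  delta_cup1 _ _ _ _ _ _.
by rewrite subrK.
Qed.

(** Inductively, [even_classSE] makes [even_class j.+1] the coboundary of [odd_transgression j] in
    the relevant degree. *)
Lemma even_class_cocycle j s : size s = j.*2.+2 -> delta (even_class j) s = 0.
Proof.
elim: j s => [|j IHj] s size_s.
  by case: s size_s => [|x [|y []]] //= _; ring.
rewrite -(delta_delta (odd_transgression j) s); apply: eq_delta => t size_t.
have {s size_s} size_t : size t = j.*2.+3 by move: size_t; rewrite size_s => -[].
case: t size_t => [|x [|y [|z t]]] // size_t.
by rewrite even_classSE IHj ?mulr0 ?addr0 //; case: size_t => /= ->.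
Qed.

(** The leading factor [x] or [wrap x y] has coboundary [y - x] or [carry x y z], and the remaining
    factor is a cocycle. *)
Lemma delta_transgression n s : size s = n.+2 ->
  delta (transgression n) s = cyc_class n.+1 s.
Proof.
rewrite /transgression /cyc_class /= uphalf_half.
have := odd_double_half n; case: (odd n) => /= def_n size_s.
  case: s size_s => [|x [|y [|z s]]] // size_s; first by move: size_s => /=; lia.
  rewrite -[RHS]/(even_class n./2.+1 [:: x, y, z & s]) even_classSE.
  rewrite even_class_cocycle ?mulr0 ?addr0 //.
  by move: size_s => /=; lia.
case: s size_s => [|x [|y s]] // size_s.
have -> : delta (even_transgression n./2) [:: x, y & s] = _ :=
  delta_cup0 id _ _ _ _.
rewrite even_class_cocycle ?mulr0 ?addr0 //.
by move: size_s => /=; lia.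
Qed.

Lemma iter_succZ i x : iter i succZ x = x + i%:R.
Proof. by elim: i => [|i /= ->]; rewrite ?addr0 // /succZ -natr1 addrA. Qed.

(** Among the pairs [z, z + d] exactly [d] wrap around, namely those with [z >= k + 2 - d]. *)
Lemma sum_wrap x y :
  \sum_(i < k.+2) wrap (iter i succZ x) (iter i succZ y) = y - x.
Proof.
transitivity (\sum_(z : Z) wrap z (z + (y - x))).
  rewrite [RHS](reindex (fun i : Z => x + i)); last first.
    by exists (fun i : Z => i - x) => i _; ring.
  apply: eq_bigr => i _; rewrite !iter_succZ.
  have -> : (i%:R : Z) = i by exact: natr_Zp.
  by congr wrap; ring.
move: (y - x) => d {x y}.
transitivity (\sum_(z < k.+2) ((k.+2 - d <= z)%N%:R : Z)).
  apply: eq_bigr => z _; rewrite /wrap /=; congr (nat_of_bool _)%:R.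
  have := ltn_ord d; have := ltn_ord z => zlt dlt.
  case: (leqP k.+2 (z + d)) => [le_zd|lt_zd].
    rewrite -{1}(subnK le_zd) modnDr modn_small; lia.
  rewrite modn_small //; lia.
rewrite -(big_mkord xpredT (fun z : nat => (k.+2 - d <= z)%N%:R : Z)).
have dlt := ltn_ord d.
rewrite (@big_cat_nat _ _ _ (k.+2 - d)) ?leq_subr //=.
rewrite big_nat_cond big1 ?add0r; last first.
  by move=> i /andP[/andP[_ lt_i] _]; rewrite leqNgt lt_i.
rewrite big_nat_cond (eq_bigr (fun=> 1)); last by move=> i /andP[/andP[-> _] _].
rewrite -big_nat_cond sumr_const_nat subKn 1?ltnW //; exact: natr_Zp.
Qed.

Lemma succ_transgression n s : ~~ odd n -> size s = n.+1 ->
  transgression n (map succZ s) - transgression n s = cyc_class n s.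
Proof.
rewrite /transgression /cyc_class => /negbTE->; case: s => // x s _.
rewrite /even_transgression /=.
by rewrite -{1}[succZ x :: _]/(map succZ (x :: s)) even_class_succ /= /succZ; ring.
Qed.

Lemma sum_transgression n s : odd n -> size s = n.+1 ->
  \sum_(i < k.+2) transgression n (map (iter i succZ) s) = cyc_class n s.
Proof.
rewrite /transgression /cyc_class => odd_n; rewrite odd_n.
case: s => [|x [|y s]] //= size_s; first by move: odd_n size_s; lia.
rewrite -sum_wrap mulr_suml; apply: eq_bigr => i _; congr (_ * _).
rewrite -[_ :: _]/(map (iter i succZ) (y :: s)); elim: (i : nat) => [|j IHj].
  by rewrite map_id.
by rewrite -[RHS]IHj -[RHS]even_class_succ -map_comp.
Qed.

(** [carry] vanishes when two adjacent arguments agree, and successive factors share an entry, so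
    every adjacent pair lies within some factor. *)
Lemma cyc_class_degenerate n s : size s = n.+1 ->
  ~~ sorted (fun x y => x != y) s -> cyc_class n s = 0.
Proof.
have even0 j t : size t = j.*2.+1 -> ~~ sorted (fun x y => x != y) t ->
    even_class j t = 0.
  elim: j t => [|j IHj] [|x [|y [|z t]]] //= [size_t].
  rewrite !negb_and !negbK => /or3P[/eqP->|/eqP->|t_eq].
  - by rewrite /carry {1}/wrap ltnn add0r subrr mul0r.
  - by rewrite /carry {2}/wrap ltnn addr0 subrr mul0r.
  - by rewrite (IHj (z :: t)) ?mulr0 //= size_t.
have := odd_double_half n; rewrite /cyc_class.
case: ifP => _ def_n size_s; last by apply: even0; lia.
case: s size_s => [|x [|y s]] //= [size_s].
rewrite negb_and negbK => /orP[/eqP->|s_eq]; first by rewrite subrr mul0r.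
by rewrite even0 ?mulr0 //=; lia.
Qed.

End CyclicCochains.

(** * A Fan lemma for cyclic groups *)

Section FanLemma.

Variables (k : nat) (E : finType) (e0 : E) (r : seq E).
Local Notation Z := 'I_k.+2.
Local Notation sgn := {ffun E -> option Z}.
Implicit Types (X Y : sgn) (s t : seq sgn) (n : nat) (e : E).

Definition sgn_le X Y := [forall e, (X e == None) || (X e == Y e)].
Definition sgn_shift X : sgn := [ffun e => omap (@succZ k) (X e)].
Definition sgn_put e X : sgn := [ffun x => if x == e then Some 0 else X x].
Definition sgn0 : sgn := [ffun=> None].

(** For duplicate-free [r] longer than [n], these form the face poset of the join of [n + 1] copies
    of [Z]. *)
Definition sgn_on n X :=
  (X != sgn0) && [forall e, (X e != None) ==> (e \in take n.+1 r)].

Definition sgn_chain n s :=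
  [&& size s == n.+1, pairwise sgn_le s & all (sgn_on n) s].

Lemma sgn_leP X Y : reflect (forall e, X e != None -> X e = Y e) (sgn_le X Y).
Proof.
apply: (iffP forallP) => XY e; have := XY e.
  by case/orP=> /eqP->.
by case: eqP => //= _ ->.
Qed.

Lemma sgn_le_trans : transitive sgn_le.
Proof.
move=> Y X W /sgn_leP XY /sgn_leP YW; apply/sgn_leP=> e Xe.
by rewrite XY // YW // -XY.
Qed.

Lemma sgn_le_shift X Y : sgn_le X Y -> sgn_le (sgn_shift X) (sgn_shift Y).
Proof.
move=> /sgn_leP XY; apply/sgn_leP=> e; rewrite !ffunE.
by case Xe: (X e) => //= _; rewrite -XY Xe.
Qed.

Lemma sgn_shift_on n X : sgn_on n X -> sgn_on n (sgn_shift X).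
Proof.
have shiftE Y e : (sgn_shift Y e == None) = (Y e == None).
  by rewrite ffunE; case: (Y e).
case/andP=> X0 /forallP supX; apply/andP; split.
  apply: contraNneq X0 => X0; apply/eqP/ffunP=> e; apply/eqP.
  by rewrite ffunE -shiftE X0 ffunE.
by apply/forallP=> e; rewrite shiftE.
Qed.

Lemma iter_sgn_shift i X e :
  iter i sgn_shift X e = omap (fun z => iter i (@succZ k) z) (X e).
Proof. by elim: i => [|i /= IHi]; rewrite ?ffunE ?IHi; case: (X e). Qed.

Lemma sgn_shift_cycle X : iter k.+2 sgn_shift X = X.
Proof.
apply/ffunP=> e; rewrite iter_sgn_shift; case: (X e) => //= z; congr Some.
have pZ : k.+2%:R = 0 :> Z by exact: (@pchar_Zp k.+2).
by rewrite -!iterS iter_succZ pZ addr0.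
Qed.

Lemma sgn_chain_shift n s : sgn_chain n s -> sgn_chain n (map sgn_shift s).
Proof.
case/and3P=> size_s le_s on_s; apply/and3P; split; first by rewrite size_map.
  by rewrite pairwise_map; apply: sub_pairwise le_s => X Y; apply: sgn_le_shift.
by rewrite all_map; apply: sub_all on_s => X; apply: sgn_shift_on.
Qed.

Lemma sgn_chain_iter_shift n i s :
  sgn_chain n s -> sgn_chain n (map (iter i sgn_shift) s).
Proof.
move=> s_ch; elim: i => [|i IHi]; first by rewrite map_id.
by rewrite (eq_map (g := sgn_shift \o iter i sgn_shift)) // map_comp sgn_chain_shift.
Qed.

Lemma sgn_le_put e X Y : sgn_le X Y -> sgn_le (sgn_put e X) (sgn_put e Y).
Proof.
move=> /sgn_leP XY; apply/sgn_leP=> x; rewrite !ffunE.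
by case: (x =P e) => // _; apply: XY.
Qed.

Definition apex n := nth e0 r n.

Hypothesis uniq_r : uniq r.

Lemma sgn_put_ge n X : (n.+1 < size r)%N -> sgn_on n X ->
  sgn_le X (sgn_put (apex n.+1) X).
Proof.
move=> n_r /andP[_ /forallP supX]; apply/sgn_leP=> x Xx; rewrite ffunE.
case: eqP => // def_x; have /implyP/(_ Xx) := supX x.
by rewrite def_x /apex in_take ?mem_nth // index_uniq // ltnn.
Qed.

Lemma sgn_put_neq0 e X : sgn_put e X != sgn0.
Proof. by apply/eqP=> /ffunP/(_ e); rewrite !ffunE eqxx. Qed.

Lemma sgn_on_put n X : (n.+1 < size r)%N -> X = sgn0 \/ sgn_on n X ->
  sgn_on n.+1 (sgn_put (apex n.+1) X).
Proof.
move=> n_r X_on; rewrite /sgn_on sgn_put_neq0.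
apply/forallP=> x; apply/implyP; rewrite ffunE.
rewrite (take_nth e0) // mem_rcons in_cons; case: (x =P _) => //= _ Xx.
case: X_on Xx => [->|/andP[_ /forallP/(_ x)/implyP]]; last exact.
by rewrite ffunE.
Qed.

Lemma sgn_on_widen n X : sgn_on n X -> sgn_on n.+1 X.
Proof.
case/andP=> X0 /forallP supX; rewrite /sgn_on X0; apply/forallP=> x.
apply/implyP=> Xx; have /implyP/(_ Xx) := supX x.
by rewrite -(take_takel r (leqnSn n.+1)) => /mem_take.
Qed.

(** If the domain of [X] precedes [apex n] in [r], then [X <= sgn_put (apex n) X >= sgn_put (apex n)
    sgn0]. Each stage of the join is thus contracted inside the next. *)
Definition apex_contraction n : (seq sgn -> Z) -> seq sgn -> Z :=
  contraction (sgn_put (apex n) sgn0) (sgn_put (apex n)).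

Definition transfer n (u : seq sgn -> Z) s : Z :=
  if odd n then \sum_(i < k.+2) u (map (iter i sgn_shift) s)
  else u (map sgn_shift s) - u s.

(* The value of a cochain on the chain [h_n], where [h_0] is a point and [h_(n+1)]
   is the contraction of [(g - 1) h_n] or of [(1 + g + ... + g^(k+1)) h_n],
   according to the parity of [n], for [g] the shift. *)
Fixpoint fundamental n (u : seq sgn -> Z) : Z :=
  if n is n'.+1 then fundamental n' (transfer n' (apex_contraction n u))
  else u [:: sgn_put (apex 0) sgn0].

Lemma eq_transfer_chain n u v s :
    (forall t, sgn_chain n t -> u t = v t) -> sgn_chain n s ->
  transfer n u s = transfer n v s.
Proof.
move=> uv s_ch; rewrite /transfer; case: ifP => _.
  by apply: eq_bigr => i _; apply/uv/sgn_chain_iter_shift.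
by rewrite !uv // sgn_chain_shift.
Qed.

Lemma eq_apex_contraction n u v s : (n.+1 < size r)%N ->
    (forall t, sgn_chain n.+1 t -> u t = v t) -> sgn_chain n s ->
  apex_contraction n.+1 u s = apex_contraction n.+1 v s.
Proof.
move=> n_r uv /and3P[/eqP size_s le_s on_s].
rewrite /apex_contraction /contraction; set f := sgn_put _.
have le_fs : pairwise sgn_le (map f s).
  by rewrite pairwise_map; apply: sub_pairwise le_s => X Y; apply: sgn_le_put.
have on_fs : all (sgn_on n.+1) (map f s).
  rewrite all_map; apply: sub_all on_s => X on_X /=.
  by apply: sgn_on_put => //; right.
congr (_ - _).
  apply/uv/and3P; split; rewrite /= ?size_map ?size_s // ?le_fs ?on_fs ?andbT.
    rewrite all_map; apply/allP=> X _ /=; apply: sgn_le_put.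
    by apply/sgn_leP=> e; rewrite ffunE.
  by apply: sgn_on_put => //; left.
apply: eq_prism => s1 X s2 def_s; apply/uv.
move: size_s le_s on_s le_fs on_fs; rewrite def_s !map_cat /=.
rewrite !size_cat !pairwise_cat !all_cat /= => size_s.
case/and3P=> le12 le1 /andP[leX le2] /and3P[on1 onX on2].
case/and3P=> _ _ /andP[lefX lef2] /and3P[_ onfX onf2].
have lef : {in s, forall Y, sgn_le Y (f Y)}.
  have on_s : all (sgn_on n) s by rewrite def_s all_cat /= on1 onX on2.
  by move=> Y /(allP on_s); apply: sgn_put_ge.
have le_f Y t : {subset t <= s} -> all (sgn_le Y) t -> all (sgn_le Y) (map f t).
  move=> t_s /allP Yt; rewrite all_map; apply/allP=> W tW /=.
  by apply: sgn_le_trans (lef _ (t_s _ tW)); apply: Yt.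
have s2_s : {subset s2 <= s}.
  by move=> Y; rewrite def_s mem_cat in_cons => ->; rewrite !orbT.
have X_s : X \in s by rewrite def_s mem_cat mem_head orbT.
rewrite /sgn_chain !pairwise_cat !all_cat !size_cat /= size_map.
rewrite lefX lef2 onfX onf2 le1 (lef X) // (le_f X) // !addnS.
rewrite -addnS size_s eqxx sgn_on_widen // (sub_all (@sgn_on_widen n) on1) !andbT /=.
apply/allrelP => Y W s1Y; have /allrelP leY := le12.
rewrite !in_cons => /or3P[/eqP->|/eqP->|].
- by apply: leY => //; rewrite mem_head.
- by apply: sgn_le_trans (lef _ X_s); apply: leY => //; rewrite mem_head.
- apply/allP/le_f => //; apply/allP=> W' s2W'.
  by apply: leY => //; rewrite in_cons s2W' orbT.
Qed.

(** [h_n] is supported on [sgn_chain n], so identities of cochains need only be checked there, where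
    lengths are known and [lam] is equivariant. *)
Lemma eq_fundamental n u v : (n < size r)%N ->
    (forall t, sgn_chain n t -> u t = v t) -> fundamental n u = fundamental n v.
Proof.
elim: n u v => [|n IHn] u v n_r uv /=.
  apply: uv; rewrite /sgn_chain /= andbT /sgn_on sgn_put_neq0.
  apply/forallP=> e; rewrite (take_nth e0) // take0 mem_seq1 !ffunE.
  by case: (e =P _).
apply: IHn => [|t t_ch]; first exact: ltnW.
apply: eq_transfer_chain t_ch => t' t'_ch; exact: eq_apex_contraction.
Qed.

Lemma transferB n u v s : 
  transfer n (fun t => u t - v t) s = transfer n u s - transfer n v s.
Proof. by rewrite /transfer; case: odd; rewrite ?sumrB //; ring. Qed.

Lemma eq_transfer n u v : u =1 v -> transfer n u =1 transfer n v.
Proof.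
by move=> uv s; rewrite /transfer !uv; case: odd => //; apply: eq_bigr => i _.
Qed.

Lemma transfer_delta n u s : transfer n (delta u) s = delta (transfer n u) s.
Proof.
rewrite /transfer; case: odd.
  by rewrite delta_sum; apply: eq_bigr => i _; rewrite delta_map.
by rewrite deltaB delta_map.
Qed.

(** The two kinds of transfer alternate, and [(g - 1) (1 + g + ... + g^(k+1)) = g^(k+2) - 1 = 0]. *)
Lemma transfer_transfer n u s : transfer n (transfer n.+1 u) s = 0.
Proof.
have sum_shift : \sum_(i < k.+2) u (map (iter i.+1 sgn_shift) s) =
    \sum_(i < k.+2) u (map (iter i sgn_shift) s).
  rewrite [LHS]big_ord_recr [RHS]big_ord_recl addrC; congr (_ + _).
  by congr u; apply: eq_map => X; apply: sgn_shift_cycle.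
rewrite /transfer /=; case: (odd n) => /=; first rewrite sumrB.
  rewrite -sum_shift (eq_bigr (fun i : 'I_k.+2 =>
    u (map (iter i.+1 sgn_shift) s))) ?subrr // => i _.
  by rewrite -map_comp.
rewrite -sum_shift (eq_bigr (fun i : 'I_k.+2 =>
  u (map (iter i.+1 sgn_shift) s))) ?subrr // => i _.
by rewrite -map_comp; congr u; apply: eq_map => X /=; rewrite -iterSr.
Qed.

Lemma fundamentalB n u v : (n < size r)%N ->
  fundamental n (fun t => u t - v t) = fundamental n u - fundamental n v.
Proof.
elim: n u v => [|n IHn] u v n_r //=.
rewrite -IHn 1?ltnW //; apply: eq_fundamental => [|t _]; first exact: ltnW.
rewrite -transferB; apply: eq_transfer => s.
by rewrite /apex_contraction /contraction prismB; ring.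
Qed.

(** Dually, the boundary of [h_(n+1)] is the chain that was contracted to build it: that chain is a
    cycle, because consecutive transfers compose to zero. *)
Lemma fundamental_delta n u : (n.+1 < size r)%N ->
  fundamental n.+1 (delta u) = fundamental n (transfer n u).
Proof.
elim: n u => [|n IHn] u n_r.
  by rewrite /= /transfer /= /apex_contraction !contraction_homotopy /=; ring.
have n_r' := ltnW n_r; set w := apex_contraction n.+2 u.
rewrite -[LHS]/(fundamental n.+1
  (transfer n.+1 (apex_contraction n.+2 (delta u)))).
transitivity (fundamental n.+1
    (fun t => transfer n.+1 u t - delta (transfer n.+1 w) t)).
  apply: eq_fundamental => // t _; rewrite -transfer_delta -transferB.
  by apply: eq_transfer => s; apply: contraction_homotopy.
rewrite fundamentalB // IHn // [X in _ - X](_ : _ = 0) ?subr0 //.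
rewrite -(subrr (fundamental n w)) -fundamentalB 1?ltnW //.
apply: eq_fundamental => [|t _]; first exact: ltnW.
rewrite subrr; exact: transfer_transfer.
Qed.

Variable lam : sgn -> Z.
Hypothesis lam_shift : forall n X, sgn_on n X -> lam (sgn_shift X) = succZ (lam X).

Lemma transfer_lam n s : sgn_chain n s ->
  transfer n (fun t => transgression n (map lam t)) s = cyc_class n (map lam s).
Proof.
move=> s_ch; case/and3P: (s_ch) => /eqP size_s _ on_s.
have lamE i : map lam (map (iter i sgn_shift) s) =
    map (iter i (@succZ k)) (map lam s).
  rewrite -!map_comp; apply/eq_in_map => X /(allP on_s) on_X /=.
  have [] // : sgn_on n (iter i sgn_shift X) /\
    lam (iter i sgn_shift X) = iter i (@succZ k) (lam X).
  elim: i => [|i [on_iX IHi]] //=; split; first exact: sgn_shift_on.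
  by rewrite (lam_shift on_iX) IHi.
rewrite /transfer; case: ifP => odd_n.
  by rewrite -sum_transgression ?size_map //; apply: eq_bigr => i _; rewrite lamE.
by rewrite (lamE 1%N) -succ_transgression ?odd_n ?size_map.
Qed.

(** The degree drops one at a time: the class is the coboundary of a transgression,
    [fundamental_delta] replaces the coboundary by a transfer, and the transfer of the transgression
    is the class one degree lower. In degree 0 the class is constantly 1. *)
Lemma fundamental_lam n : (n < size r)%N ->
  fundamental n (fun t => cyc_class n (map lam t)) = 1.
Proof.
elim: n => [|n IHn] n_r //.
rewrite -[RHS]IHn 1?ltnW //.
transitivity (fundamental n.+1 (delta (fun t => transgression n (map lam t)))).
  apply: eq_fundamental => // t /and3P[/eqP size_t _ _].
  by rewrite delta_map delta_transgression // size_map.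
rewrite fundamental_delta //; apply: eq_fundamental => [|t]; first exact: ltnW.
exact: transfer_lam.
Qed.

Lemma fan_chain n : (n < size r)%N ->
  ~ (forall s, sgn_chain n s -> ~~ sorted (fun x y => x != y) (map lam s)).
Proof.
move=> n_r no_alt; have := fundamental_lam n_r => /eqP; apply/negP.
suff -> : fundamental n (fun t => cyc_class n (map lam t)) = 0.
  by rewrite eq_sym oner_eq0.
rewrite -(subrr (fundamental n (fun=> 0))) -fundamentalB //.
apply: eq_fundamental => // s s_ch; rewrite subrr cyc_class_degenerate ?no_alt //.
by rewrite size_map; case/and3P: s_ch => /eqP.
Qed.

End FanLemma.

(** * The Cauchy-Davenport theorem *)

Section CauchyDavenport.

Variable p : nat.
Hypothesis p_pr : prime p.
Implicit Types A B : {set 'F_p}.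

Definition sumset A B : {set 'F_p} := [set a + b | a in A, b in B].

Lemma mem_sumset A B a b : a \in A -> b \in B -> a + b \in sumset A B.
Proof. by move=> aA bB; apply: imset2_f. Qed.

(** A nonzero [d] generates ['F_p] additively, so every [x] is [a0] plus a multiple of [d]. *)
Lemma translation_invariant_setT A (d : 'F_p) : d != 0 -> A != set0 ->
  (forall a, a \in A -> a + d \in A) -> A = setT.
Proof.
move=> d0 /set0Pn[a0 a0A] Ad; apply/setP=> x; rewrite inE.
have A_mul (j : nat) : a0 + d *+ j \in A.
  by elim: j => [|j IHj]; rewrite ?mulr0n ?addr0 // mulrSr addrA Ad.
have := A_mul ((x - a0) / d : 'F_p).
by rewrite -mulr_natr natr_Zp mulrC divfK // addrC subrK.
Qed.

(** Induction on [#|B|] by the Dyson transform: passing to the union of [A] and [B + e], and the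
    intersection of [B] and [A - e], keeps the sum of the cardinals and does not enlarge the
    sumset. *)
Lemma cauchy_davenport A B : A != set0 -> B != set0 ->
  (minn p (#|A| + #|B|).-1 <= #|sumset A B|)%N.
Proof.
move: {2}#|B| (leqnn #|B|) => n; elim: n A B => [|n IHn] A B leB A0 B0.
  by rewrite -card_gt0 in B0; lia.
have [b bB] := set0Pn _ B0.
have leA : (#|A| <= #|sumset A B|)%N.
  rewrite -(card_imset A (addIr b)); apply: subset_leq_card.
  by apply/subsetP=> _ /imsetP[a aA ->]; apply: mem_sumset.
have [B1|B2] := leqP #|B| 1.
  by apply: leq_trans leA; rewrite geq_min; apply/orP; right; lia.
have [A_full|A_proper] := eqVneq A setT.
  by apply: leq_trans leA; rewrite geq_min A_full cardsT card_Fp ?leqnn.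
have [b' b'B nbb'] : exists2 b', b' \in B & b' != b.
  have : (0 < #|B :\ b|)%N by rewrite (cardsD1 b) bB in B2.
  by case/card_gt0P=> b'; rewrite !inE => /andP[? ?]; exists b'.
(* A proper [A] is not invariant under translation by [b' - b]. With [e = a - b], the transform
   keeps [b] in the second set and expels [b']. *)
have [a aA a_out] : exists2 a, a \in A & a + (b' - b) \notin A.
  apply/exists_inP; apply: contraNT A_proper; rewrite negb_exists_in => /forall_inP h.
  apply/eqP/(@translation_invariant_setT _ (b' - b)); rewrite ?subr_eq0 //.
  by move=> a /h; rewrite negbK.
pose e := a - b; pose C := [set x + e | x in B].
pose A' := A :|: C; pose B' := [set x in B | x + e \in A].
have bB' : b \in B' by rewrite inE bB addrC subrK.
have ltB' : (#|B'| < #|B|)%N.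
  apply/proper_card/properP; split; first by apply/subsetP=> x; rewrite inE => /andP[].
  exists b' => //; rewrite inE b'B /=.
  by have -> : b' + e = a + (b' - b) by rewrite /e; ring.
have card_eq : (#|A'| + #|B'| = #|A| + #|B|)%N.
  have -> : #|B'| = #|A :&: C|.
    rewrite -(card_imset B' (addIr e)); apply: eq_card => x; rewrite inE.
    apply/imsetP/andP=> [[y]|[xA /imsetP[y yB def_x]]].
      by rewrite inE => /andP[yB yA] ->; split=> //; apply: imset_f.
    by exists y => //; rewrite inE yB -def_x.
  by rewrite cardsUI card_imset //; apply: addIr.
rewrite -card_eq; apply: leq_trans (IHn A' B' _ _ _) _.
- by rewrite -ltnS; apply: leq_trans leB.
- by apply/set0Pn; exists a; rewrite inE aA.
- by apply/set0Pn; exists b.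
apply/subset_leq_card/subsetP=> _ /imset2P[x y xA' + ->].
rewrite inE => /andP[yB yeA]; case/setUP: xA' => [xA|/imsetP[z zB ->]].
  exact: mem_sumset.
have -> : z + e + y = (y + e) + z by ring.
exact: mem_sumset.
Qed.

(** Iterating Cauchy-Davenport, the sumset of all the [S i] has at least
    [minn p (\sum_i #|S i|.-1).+1] elements, hence is everything. *)
Lemma sum_transversal (I : finType) (S : I -> {set 'F_p}) (x : 'F_p) :
    (forall i, S i != set0) -> (p <= (\sum_i #|S i|.-1).+1)%N ->
  exists f : {ffun I -> 'F_p}, (forall i, f i \in S i) /\ \sum_i f i = x.
Proof.
move=> S0 le_p; set r := index_enum I; have : uniq r := index_enum_uniq I.
pose T s : {set 'F_p} := \big[sumset/[set 0]]_(i <- s) S i.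
have T0 s : T s != set0.
  rewrite /T; elim: s => [|i s IHs].
    by rewrite big_nil; apply/set0Pn; exists 0; rewrite inE.
  rewrite big_cons; have [a aS] := set0Pn _ (S0 i); have [b bT] := set0Pn _ IHs.
  by apply/set0Pn; exists (a + b); exact: (mem_sumset aS bT).
have leT s : (minn p (\sum_(i <- s) #|S i|.-1).+1 <= #|T s|)%N.
  elim: s => [|i s IHs]; first by rewrite big_nil /T big_nil cards1 geq_minr.
  have := cauchy_davenport (S0 i) (T0 s).
  have -> : T (i :: s) = sumset (S i) (T s) by rewrite /T big_cons.
  by rewrite big_cons; have := S0 i; rewrite -card_gt0; lia.
have Tx : x \in T r.
  suff -> : T r = setT by rewrite inE.
  apply/eqP; rewrite eqEcard subsetT cardsT card_Fp //.
  by apply: leq_trans (leT r); rewrite leq_min leqnn.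
have f0 i : {a | a \in S i} by apply/sigW/set0Pn.
elim: r x Tx {le_p} => [|i r IHr] x.
  rewrite /T big_nil inE => /eqP -> _.
  exists [ffun i => sval (f0 i)]; split=> [i|]; last by rewrite big_nil.
  by rewrite ffunE; case: (f0 i).
rewrite /T big_cons => /imset2P[a b aS bT ->] /= /andP[ir uniq_r].
have [f [fS <-]] := IHr b bT uniq_r.
exists [ffun j => if j == i then a else f j]; split=> [j|].
  by rewrite ffunE; case: eqP => [->|].
rewrite big_cons ffunE eqxx; congr (_ + _); apply: eq_big_seq => j jr.
by rewrite ffunE; case: eqP => // ji; rewrite -ji jr in ir.
Qed.

(** Turns weights of nonzero total into a point that rotates with them. *)
Definition barycenter (a : 'F_p -> 'F_p) : 'F_p :=
  (\sum_i i * a i) / (\sum_i a i).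

Lemma eq_barycenter a b : a =1 b -> barycenter a = barycenter b.
Proof.
by move=> ab; congr (_ / _); apply: eq_bigr => i _; rewrite ab.
Qed.

Lemma barycenter_shift (a b : 'F_p -> 'F_p) :
    (forall i, b (i + 1) = a i) -> \sum_i a i != 0 ->
  barycenter b = barycenter a + 1.
Proof.
move=> ab a0; rewrite /barycenter.
have -> : \sum_i b i = \sum_i a i.
  by rewrite (reindex_inj (addIr 1)); apply: eq_bigr.
rewrite -[1 in RHS](divff a0) -mulrDl; congr (_ / _).
rewrite (reindex_inj (addIr 1)) -big_split; apply: eq_bigr => i _ /=.
by rewrite ab mulrDl mul1r.
Qed.

End CauchyDavenport.

(** * Zero-sum families *)

Section ZeroSumProperty.
Local Open Scope nat_scope.

Section Definitions.

Variables (I E : finType) (F : {set {set E}}) (B : {set E}).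
Implicit Type A : {ffun I -> {set E}}.

Definition disjoint_family A :=
  [forall i, forall j, (i != j) ==> [disjoint A i & A j]].

Definition avoiding_family A :=
  disjoint_family A &&
  [forall i, (A i \subset B) && [forall X in F, ~~ (X \subset A i)]].

(* That is, the [#|I|]-colorability defect of the members of [F] contained in
   [B] is at least [2 * #|I| - 1], unless [set0] is in [F]. *)
Definition defective :=
  [forall A, avoiding_family A ==> (\sum_i #|A i| + 2 * #|I| <= #|B|.+1)].

Definition zero_sum_family (c : {set E} -> nat) A :=
  [&& disjoint_family A, [forall i, (A i \in F) && (A i \subset B)]
    & #|I| %| \sum_i c (A i)].

Lemma disjoint_familyP A :
  reflect (forall i j, i != j -> [disjoint A i & A j]) (disjoint_family A).
Proof.
by apply: (iffP 'forall_forallP) => Ad i j; apply/implyP; apply: Ad.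
Qed.

Lemma avoiding_familyP A :
  reflect [/\ disjoint_family A, forall i, A i \subset B
            & forall i X, X \in F -> ~~ (X \subset A i)] (avoiding_family A).
Proof.
apply: (iffP andP) => [[Ad /forallP AB]|[Ad AB AF]].
  by split=> // i; have /andP[? /forall_inP] := AB i.
by split=> //; apply/forallP=> i; rewrite AB; apply/forall_inP; apply: AF.
Qed.

Lemma disjoint_family_prod (J : finType) (D : J -> {set E})
    (W : J -> {ffun I -> {set E}}) :
    (forall j j', j != j' -> [disjoint D j & D j']) ->
    (forall j, disjoint_family (W j)) -> (forall j i, W j i \subset D j) ->
  forall ij ij' : I * J, ij != ij' ->
  [disjoint W ij.2 ij.1 & W ij'.2 ij'.1].
Proof.
move=> Dd Wd WD [i j] [i' j'] /=; have [<-|nj _] := eqVneq j j'.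
  rewrite xpair_eqE eqxx andbT => ni.
  by move/disjoint_familyP: (Wd j); apply.
exact: disjointW (WD j i) (WD j' i') (Dd _ _ nj).
Qed.

End Definitions.

(** Arbitrary index types let a product of moduli be indexed by a product type; the subset [B]
    allows use inside a smaller set, and colours in [nat] can be divided by [#|I|]. *)
Definition zero_sum_property (I : finType) :=
  forall (E : finType) (F : {set {set E}}) (B : {set E}) (c : {set E} -> nat),
  defective I F B -> exists A : {ffun I -> {set E}}, zero_sum_family F B c A.

Lemma zero_sum_property_card (I J : finType) :
  #|I| = #|J| -> zero_sum_property I -> zero_sum_property J.
Proof.
move=> cardIJ zsI E F B c defJ.
pose g (j : J) : I := enum_val (cast_ord (esym cardIJ) (enum_rank j)).
pose h (i : I) : J := enum_val (cast_ord cardIJ (enum_rank i)).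
have gK : cancel g h by move=> j; rewrite /h enum_valK cast_ordKV enum_rankK.
have hK : cancel h g by move=> i; rewrite /g enum_valK cast_ordK enum_rankK.
have sum_g (f : I -> nat) : \sum_j f (g j) = \sum_i f i.
  by rewrite [RHS](reindex g) //; exists h => ? _.
have [|A /and3P[/disjoint_familyP Ad /forallP AF Ac]] := zsI E F B c.
  apply/forallP=> A; apply/implyP=> /avoiding_familyP[/disjoint_familyP Ad AB AF].
  have -> : \sum_i #|A i| = \sum_j #|[ffun j => A (g j)] j|.
    by rewrite -sum_g; apply: eq_bigr => j _; rewrite ffunE.
  move/forallP/(_ [ffun j => A (g j)])/implyP: defJ.
  rewrite cardIJ; apply; apply/avoiding_familyP; split=> [|j|j X].
  - apply/disjoint_familyP => i j ij; rewrite !ffunE Ad //.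
    by rewrite (can_eq gK).
  - by rewrite ffunE.
  - by rewrite ffunE; apply: AF.
exists [ffun j => A (g j)]; apply/and3P; split.
- apply/disjoint_familyP => i j ij; rewrite !ffunE Ad //.
  by rewrite (can_eq gK).
- by apply/forallP=> j; rewrite ffunE.
- rewrite -cardIJ; under eq_bigr => j _ do rewrite ffunE.
  by rewrite (sum_g (fun i => c (A i))).
Qed.

(* Apply the property of [J] to the family of sets that are defective for [I],
   a set being coloured by the sum of a zero-sum [I]-family inside it, divided
   by [#|I|]. *)
Lemma zero_sum_property_prod (I J : finType) :
  zero_sum_property I -> zero_sum_property J -> zero_sum_property (I * J)%type.
Proof.
move=> zsI zsJ E F B c defIJ.
pose G := [set D : {set E} | defective I F D].
pose edge D : {ffun I -> {set E}} :=
  odflt [ffun=> set0] [pick A | zero_sum_family F D c A].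
have edgeP D : D \in G -> zero_sum_family F D c (edge D).
  rewrite inE => /(zsI _ _ _ c)[A Azs]; rewrite /edge.
  by case: pickP => [//|/(_ A)]; rewrite Azs.
have [|D /and3P[/disjoint_familyP Dd /forallP DG Dc]] :=
    zsJ E G B (fun D => (\sum_i c (edge D i)) %/ #|I|).
  apply/forallP=> D; apply/implyP=> /avoiding_familyP[/disjoint_familyP Dd DB DG].
  (* [D j] contains no member of [G], so it is not defective itself; a witness is an [F]-avoiding
     family inside [D j] that is too large. *)
  have W j : {A : {ffun I -> {set E}} | avoiding_family F (D j) A
      && (#|D j| + 2 <= \sum_i #|A i| + 2 * #|I|)}.
    apply/sigW; have : D j \notin G by apply: contraL (subxx (D j)); apply: DG.
    rewrite inE negb_forall => /existsP[A]; rewrite negb_imply => /andP[A_av].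
    by rewrite -ltnNge => ltA; exists A; rewrite A_av addn2.
  pose V := [ffun ij : I * J => sval (W ij.2) ij.1].
  move/forallP/(_ V)/implyP: defIJ => defV.
  have {defV} leV : \sum_j \sum_i #|sval (W j) i| + 2 * (#|I| * #|J|) <= #|B|.+1.
    rewrite exchange_big pair_big -card_prod.
    rewrite (eq_bigr (fun ij => #|V ij|)) => [|ij _]; last by rewrite ffunE.
    apply: defV; apply/avoiding_familyP; split=> [|[i j]|[i j] X].
    - apply/disjoint_familyP => ij ij' nij; rewrite !ffunE.
      apply: (disjoint_family_prod Dd (W := fun j => sval (W j))) nij => j.
        by case: (W j) => A /= /andP[/avoiding_familyP[]].
      by case: (W j) => A /= /andP[/avoiding_familyP[]].
    - rewrite ffunE /=; case: (W j) => A /= /andP[/avoiding_familyP[_ AB _] _].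
      exact: subset_trans (AB i) (DB j).
    - rewrite ffunE /=; case: (W j) => A /= /andP[/avoiding_familyP[_ _ AF] _].
      exact: AF.
  apply: leq_trans leV.
  have sumJ n : \sum_(j : J) n = #|J| * n by rewrite sum_nat_const.
  have : \sum_j (#|D j| + 2) <= \sum_j (\sum_i #|sval (W j) i| + 2 * #|I|).
    by apply: leq_sum => j _; case: (W j) => A /= /andP[].
  rewrite big_split [leqRHS]big_split !sumJ /=.
  move: (\sum_j \sum_i #|sval (W j) i|) => w; lia.
exists [ffun ij => edge (D ij.2) ij.1].
have edgeD j := edgeP _ (proj1 (andP (DG j))).
apply/and3P; split.
- apply/disjoint_familyP => ij ij' nij; rewrite !ffunE.
  apply: (disjoint_family_prod Dd (W := fun j => edge (D j))) nij => j.
    by have /and3P[] := edgeD j.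
  by move=> i; have /and3P[_ /forallP/(_ i)/andP[]] := edgeD j.
- apply/forallP=> [[i j]]; rewrite ffunE /=.
  have /and3P[_ /forallP/(_ i)/andP[-> eD] _] := edgeD j.
  by apply: subset_trans eD _; have /andP[] := DG j.
- under eq_bigr => ij _ do rewrite ffunE.
  rewrite -(pair_big xpredT xpredT (fun i j => c (edge (D j) i))) exchange_big /=.
  (* Each inner sum is a multiple of [#|I|], and the quotients add up to a multiple of [#|J|]. *)
  have -> : \sum_j \sum_i c (edge (D j) i) =
      #|I| * \sum_j ((\sum_i c (edge (D j) i)) %/ #|I|).
    rewrite big_distrr; apply: eq_bigr => j _ /=; rewrite mulnC divnK //.
    by have /and3P[] := edgeD j.
  by rewrite card_prod dvdn_mul.
Qed.

End ZeroSumProperty.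

Lemma leqif_sum_card (I T : finType) (A B : I -> {set T}) :
    (forall i, A i \subset B i) ->
  (\sum_i #|A i| <= \sum_i #|B i| ?= iff [forall i, A i == B i])%N.
Proof.
by move=> AB; apply: leqif_sum => i _; apply: subset_leqif_cards.
Qed.

(** * Prime modulus: an equivariant label and a monotone rank on partial maps *)

Section PrimeCase.

Variables (p : nat) (E : finType) (F : {set {set E}}) (B : {set E}).
Variable c : {set E} -> nat.
Hypothesis p_pr : prime p.
Hypothesis no_zero_sum : forall A : {ffun 'F_p -> {set E}},
  ~~ zero_sum_family F B c A.
Hypothesis defB : defective 'F_p F B.

Local Notation sgn := {ffun E -> option 'F_p}.
Implicit Types (X Y : sgn) (i : 'F_p).

Definition cell X i : {set E} := [set x | X x == Some i].

Definition colors X i : {set 'F_p} :=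
  [set (c V)%:R | V in F & V \subset cell X i].

Definition signed_in X := (X != sgn0 _ E) && [forall x, (X x != None) ==> (x \in B)].

Definition all_empty X := [forall i, colors X i == set0].
Definition some_empty X := [exists i, colors X i == set0].

(** The element picked depends only on the domain of [X], which the shift preserves. *)
Definition first_sign X : 'F_p :=
  if [pick x | X x != None] is Some x then odflt 0 (X x) else 0.

(* The weights must not sum to 0 in 'F_p.  When [\sum_i #|colors X i| = p] the
   cardinals do, but then the [colors X i] are singletons, and their elements
   do not sum to 0 as there is no zero-sum family. *)
Definition label X : 'F_p :=
  if all_empty X then first_sign X
  else if some_empty X then
    barycenter (fun i => (colors X i != set0)%:R)
  else if (\sum_i #|colors X i| == p)%N then
    barycenter (fun i => \sum_(z in colors X i) z)
  else barycenter (fun i => #|colors X i|%:R).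

(** For signed [X] in [B] the three cases take values in consecutive intervals: up to
    [#|B|.+1 - 2 * p] by the defect, then the next [p - 1] values, then up to [#|B|.-1]. *)
Definition rank X : nat :=
  (if all_empty X then \sum_i #|cell X i|
   else #|B|.+1 - 2 * p +
     (if some_empty X then #|[set i | colors X i != set0]|
      else \sum_i #|colors X i|))%N.

Lemma cell_mono X Y i : sgn_le X Y -> cell X i \subset cell Y i.
Proof.
move=> /sgn_leP XY; apply/subsetP=> x; rewrite !inE => /eqP Xx.
by rewrite -XY Xx.
Qed.

Lemma colors_mono X Y i : sgn_le X Y -> colors X i \subset colors Y i.
Proof.
move=> XY; apply/subsetP=> _ /imsetP[V + ->]; rewrite inE => /andP[VF VX].
by apply: imset_f; rewrite inE VF (subset_trans VX) ?cell_mono.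
Qed.

Lemma cell_disjoint X i j : i != j -> [disjoint cell X i & cell X j].
Proof.
move=> ij; rewrite disjoint_subset; apply/subsetP=> x; rewrite !inE => /eqP->.
by apply: contraNneq ij => -[->].
Qed.

Lemma cell_sub X i : signed_in X -> cell X i \subset B.
Proof.
case/andP=> _ /forallP XB; apply/subsetP=> x; rewrite inE => /eqP Xx.
by have := XB x; rewrite Xx.
Qed.

Lemma cell_eq X Y : (forall i, cell X i = cell Y i) -> X = Y.
Proof.
move=> XY; apply/ffunP=> x.
have XYx i : (X x == Some i) = (Y x == Some i) by have /setP/(_ x) := XY i; rewrite !inE.
case Xx: (X x) (XYx) => [i|] XYi.
  by have := XYi i; rewrite eqxx => /esym/eqP.
by case: (Y x) XYi => // j /(_ j); rewrite eqxx.
Qed.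

Lemma cell_shift X i : cell (sgn_shift X) (i + 1) = cell X i.
Proof.
apply/setP=> x; rewrite !inE ffunE; case: (X x) => //= j.
by rewrite /eq_op /= -/(_ == _ :> 'F_p) (inj_eq (addIr 1)).
Qed.

Lemma colors_shift X i : colors (sgn_shift X) (i + 1) = colors X i.
Proof. by rewrite /colors cell_shift. Qed.

(** Members of [F] realizing the colours [f i] lie in different cells, hence are disjoint; a
    vanishing sum would make them a zero-sum family. *)
Lemma sum_colors_neq0 X (f : 'F_p -> 'F_p) : signed_in X ->
  (forall i, f i \in colors X i) -> \sum_i f i != 0.
Proof.
move=> Xin fX.
have V i : {V | [&& V \in F, V \subset cell X i & f i == (c V)%:R]}.
  apply/sigW; have /imsetP[V] := fX i; rewrite inE => /andP[VF VX] ->.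
  by exists V; rewrite VF VX eqxx.
apply: contra (no_zero_sum [ffun i => sval (V i)]) => /eqP f0; apply/and3P; split.
- apply/disjoint_familyP=> i j ij; rewrite !ffunE.
  case: (V i) (V j) => [Vi /= /and3P[_ Vi_X _]] [Vj /= /and3P[_ Vj_X _]].
  exact: disjointW Vi_X Vj_X (cell_disjoint _ ij).
- apply/forallP=> i; rewrite ffunE; case: (V i) => [W /= /and3P[-> WX _]].
  exact: subset_trans WX (cell_sub _ Xin).
- rewrite card_Fp // (dvdn_pcharf (pchar_Fp p_pr)) natr_sum -[X in _ == X]f0.
  apply/eqP/eq_bigr => i _; rewrite ffunE.
  by case: (V i) => [W /= /and3P[_ _ /eqP->]].
Qed.

Lemma set0_notin : set0 \notin F.
Proof.
apply: contra (no_zero_sum [ffun=> set0]) => F0; apply/and3P; split.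
- by apply/disjoint_familyP=> i j _; rewrite !ffunE disjoints_subset sub0set.
- by apply/forallP=> i; rewrite ffunE F0 sub0set.
- rewrite (eq_bigr (fun=> c set0)) => [|i _]; last by rewrite ffunE.
  by rewrite sum_nat_const dvdn_mulr.
Qed.

(** The family of empty sets avoids [F] by [set0_notin]. The bound keeps [#|B|.+1 - 2 * p] from
    being truncated. *)
Lemma card_B_ge : (2 * p <= #|B|.+1)%N.
Proof.
move/forallP/(_ [ffun=> set0])/implyP: defB; rewrite card_Fp // => defB0.
apply: leq_trans (leq_addl _ _) (defB0 _); apply/avoiding_familyP; split=> [|i|i V VF].
- by apply/disjoint_familyP=> i j _; rewrite !ffunE disjoints_subset sub0set.
- by rewrite ffunE sub0set.
- by rewrite ffunE subset0; apply: contraNneq set0_notin => <-.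
Qed.

Lemma sum_cell_le X : signed_in X -> all_empty X ->
  (\sum_i #|cell X i| <= #|B|.+1 - 2 * p)%N.
Proof.
move=> Xin /forallP X0; move/forallP/(_ [ffun i => cell X i])/implyP: defB.
rewrite card_Fp // (eq_bigr (fun i => #|cell X i|)) => [defX|i _]; last by rewrite ffunE.
rewrite leq_subRL ?card_B_ge // addnC; apply: defX.
apply/avoiding_familyP; split=> [|i|i V VF].
- by apply/disjoint_familyP=> i j ij; rewrite !ffunE cell_disjoint.
- by rewrite ffunE cell_sub.
- rewrite ffunE; apply: contraTN (X0 i) => VX; apply/set0Pn; exists (c V)%:R.
  by apply: imset_f; rewrite inE VF.
Qed.

Lemma sum_cell_gt0 X : signed_in X -> (0 < \sum_i #|cell X i|)%N.
Proof.
case/andP=> X0 _; rewrite lt0n; apply: contraNneq X0 => /eqP.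
rewrite sum_nat_eq0 => /forallP cell0; apply/eqP/cell_eq => i.
have /eqP := cell0 i => /eqP; rewrite cards_eq0 => /eqP->.
by apply/esym/setP=> x; rewrite !inE ffunE.
Qed.

Lemma card_nonempty_gt0 X : ~~ all_empty X ->
  (0 < #|[set i | colors X i != set0]|)%N.
Proof.
by rewrite negb_forall => /existsP[i Xi]; apply/card_gt0P; exists i; rewrite inE.
Qed.

Lemma card_nonempty_lt X : some_empty X ->
  (#|[set i | colors X i != set0]| < p)%N.
Proof.
case/existsP=> i Xi.
suff : (#|[set i | colors X i != set0]| < #|[set: 'F_p]|)%N.
  by rewrite cardsT card_Fp.
apply: proper_card.
by apply/properP; split=> //; exists i; rewrite !inE // negbK.
Qed.

Lemma sum_pred_colors X : ~~ some_empty X ->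
  (\sum_i #|colors X i| = \sum_i #|colors X i|.-1 + p)%N.
Proof.
rewrite negb_exists => /forallP X0.
transitivity (\sum_i (#|colors X i|.-1 + 1))%N; last first.
  by rewrite big_split /= sum1_card card_Fp.
apply: eq_bigr => i _; by rewrite addn1 prednK // card_gt0.
Qed.

(** Otherwise [sum_transversal] would select one colour per cell with sum 0. *)
Lemma sum_colors_lt X : signed_in X -> ~~ some_empty X ->
  (\sum_i #|colors X i| < 2 * p - 1)%N.
Proof.
move=> Xin X0; rewrite ltnNge; apply/negP => le_sum.
have [i|| f [fX f0]] := @sum_transversal p p_pr _ (colors X) 0.
- by move: X0; rewrite negb_exists => /forallP.
- by have := prime_gt1 p_pr; have := sum_pred_colors X0; lia.
- by have := sum_colors_neq0 Xin fX; rewrite f0 eqxx.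
Qed.

Lemma natF_neq0 n : (0 < n < p)%N || (p < n < 2 * p)%N -> n%:R != 0 :> 'F_p.
Proof.
rewrite -(dvdn_pcharf (pchar_Fp p_pr)) => lt_n; apply/dvdnP => -[q def_n].
by move: lt_n; rewrite def_n; case: q {def_n} => [|[|q]]; nia.
Qed.

(** The shift rotates the sets [colors X i], so it remains to see that total weights are nonzero:
    the number of nonempty colour sets is strictly between 0 and [p], a sum of one colour per cell
    is nonzero, and the remaining cardinal sums lie strictly between [p] and [2 * p]. *)
Lemma label_shift X : signed_in X -> label (sgn_shift X) = succZ (label X).
Proof.
move=> Xin; have shiftE := colors_shift X.
have bij1 : bijective (fun i : 'F_p => i + 1) by exists (fun i => i - 1) => i; ring.
have forall_shift (P : pred {set 'F_p}) :
    [forall i, P (colors (sgn_shift X) i)] = [forall i, P (colors X i)].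
  apply/forallP/forallP=> PX i; first by rewrite -shiftE.
  by rewrite -(subrK 1 i) shiftE.
have exists_shift (P : pred {set 'F_p}) :
    [exists i, P (colors (sgn_shift X) i)] = [exists i, P (colors X i)].
  apply: negb_inj; rewrite !negb_exists; exact: (forall_shift (fun S => ~~ P S)).
rewrite /label (forall_shift (pred1 set0) : all_empty _ = all_empty X).
rewrite (exists_shift (pred1 set0) : some_empty _ = some_empty X).
have -> : (\sum_i #|colors (sgn_shift X) i| = \sum_i #|colors X i|)%N.
  by rewrite (reindex _ (onW_bij _ bij1)); apply: eq_bigr => i _; rewrite shiftE.
case: ifP => [_|X_nempty].
  rewrite /first_sign (eq_pick (Q := fun x => X x != None)); last first.
    by move=> x; rewrite ffunE; case: (X x).
  case: pickP => [x Xx|X0]; first by rewrite ffunE; case: (X x) Xx.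
  case/andP: Xin => /eqP[]; apply/ffunP=> x; rewrite ffunE.
  by apply/eqP; have := X0 x; case: eqP.
case: ifP => [X_some|/negbT X_some].
  apply: barycenter_shift => // [i|]; first by rewrite shiftE.
  have -> : \sum_i (colors X i != set0)%:R =
      #|[set i | colors X i != set0]|%:R :> 'F_p.
    by rewrite -natr_sum -sum1dep_card [in RHS]big_mkcond.
  rewrite natF_neq0 //.
  by rewrite card_nonempty_gt0 ?card_nonempty_lt ?X_nempty.
have sumE := sum_pred_colors X_some.
case: eqP => [sum_p|/eqP sum_np].
  apply: barycenter_shift => // [i|]; first by rewrite shiftE.
  apply: (sum_colors_neq0 Xin) => i.
  have /eqP : (\sum_i #|colors X i|.-1 = 0)%N by lia.
  rewrite sum_nat_eq0 => /forallP/(_ i)/implyP/(_ isT)/eqP Xi.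
  have /cards1P[z ->] : #|colors X i| == 1%N.
    move: X_some; rewrite negb_exists => /forallP/(_ i).
    by rewrite -card_gt0; lia.
  by rewrite big_set1 inE.
apply: barycenter_shift => // [i|]; first by rewrite shiftE.
rewrite -natr_sum natF_neq0 //.
by have := sum_colors_lt Xin X_some; move/eqP: sum_np; lia.
Qed.

Lemma rank_bounds X : signed_in X -> (0 < rank X < #|B|)%N.
Proof.
move=> Xin; have := card_B_ge; rewrite /rank.
have p_gt1 := prime_gt1 p_pr.
case: ifP => [X0|/negbT X0].
  by have := sum_cell_gt0 Xin; have := sum_cell_le Xin X0; lia.
case: ifP => [X1|/negbT X1].
  by have := card_nonempty_gt0 X0; have := card_nonempty_lt X1; lia.
by have := sum_colors_lt Xin X1; have := sum_pred_colors X1; lia.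
Qed.

(** By contraposition: moving to a later case raises the rank, and within one case an equal rank
    forces equality of the growing data from which the label is computed. *)
Lemma rank_lt X Y : signed_in X -> signed_in Y -> sgn_le X Y ->
  label X != label Y -> (rank X < rank Y)%N.
Proof.
move=> Xin Yin XY; apply: contraNltn; rewrite /rank /label.
have colXY i := colors_mono i XY.
have Y0X0 : all_empty Y -> all_empty X.
  move=> /forallP Y0; apply/forallP=> i; rewrite -subset0.
  by apply: subset_trans (colXY i) _; rewrite (eqP (Y0 i)).
have Y1X1 : some_empty Y -> some_empty X.
  case/existsP=> i Yi; apply/existsP; exists i; rewrite -subset0.
  by apply: subset_trans (colXY i) _; rewrite (eqP Yi).
have [X0|X0] := boolP (all_empty X).
  have [Y0|Y0] := boolP (all_empty Y).
    have /leqif_sum_card cells i := cell_mono i XY.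
    rewrite (geq_leqif cells) => /forallP cellE.
    by rewrite (cell_eq (fun i => eqP (cellE i))).
  have := sum_cell_le Xin X0; case: ifP => [Y1|/negbT Y1].
    by have := card_nonempty_gt0 Y0; lia.
  by have := sum_pred_colors Y1; have := prime_gt0 p_pr; lia.
rewrite (negPf (contra Y0X0 X0)) leq_add2l.
have [X1|X1] := boolP (some_empty X); last first.
  rewrite (negPf (contra Y1X1 X1)) (geq_leqif (leqif_sum_card colXY)).
  move=> /forallP colE; have {}colE i : colors X i = colors Y i := eqP (colE i).
  have -> : (\sum_i #|colors X i| = \sum_i #|colors Y i|)%N.
    by apply: eq_bigr => i _; rewrite colE.
  by case: ifP => _; apply/eqP/eq_barycenter => i; rewrite colE.
have [Y1|Y1] := boolP (some_empty Y); last first.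
  by have := card_nonempty_lt X1; have := sum_pred_colors Y1; lia.
have subXY : [set i | colors X i != set0] \subset [set i | colors Y i != set0].
  apply/subsetP=> i; rewrite !inE; apply: contraNneq => Yi.
  by rewrite -subset0 -Yi.
rewrite (geq_leqif (subset_leqif_cards subXY)) => /eqP/setP eqXY.
by apply/eqP/eq_barycenter => i; have := eqXY i; rewrite !inE => ->.
Qed.

Lemma prime_case_absurd : False.
Proof.
have B_gt0 : (0 < #|B|)%N by have := card_B_ge; have := prime_gt1 p_pr; lia.
have [e0 _] := card_gt0P B_gt0.
have on_in n X : sgn_on (enum B) n X -> signed_in X.
  case/andP=> X0 /forallP XB; apply/andP; split=> //; apply/forallP=> x.
  by apply/implyP=> /(implyP (XB x))/mem_take; rewrite mem_enum.
(* ['F_p] is convertible to some ['I_k.+2]; degree [#|B|.-1] means chains of [#|B|] partial maps. *)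
apply: (@fan_chain _ E e0 (enum B) (enum_uniq _) label _ #|B|.-1).
- by move=> n X /on_in; apply: label_shift.
- by rewrite -cardE prednK.
move=> s /and3P[/eqP size_s le_s on_s]; apply/negP=> alt_s.
have in_s : all signed_in s by apply: sub_all on_s; apply: on_in.
have rank_s : sorted ltn (map rank s).
  rewrite sorted_map; apply: (sub_in_sorted (P := signed_in)
    (e := [rel X Y | sgn_le X Y && (label X != label Y)])) in_s _.
    by move=> X Y Xin Yin /andP[]; apply: rank_lt.
  move: alt_s; rewrite sorted_map => alt_s.
  by rewrite sorted_relI; apply/andP; split; [apply: pairwise_sorted|].
(* Pigeonhole: [#|B|] strictly increasing ranks would fit into [#|B|.-1] values. *)
have rank_iota : {subset map rank s <= iota 1 #|B|.-1}.
  move=> _ /mapP[X Xs ->]; rewrite mem_iota.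
  by have := rank_bounds (allP in_s _ Xs); lia.
have := uniq_leq_size (sorted_uniq ltn_trans ltnn rank_s) rank_iota.
by rewrite size_map size_iota size_s ltnn.
Qed.

End PrimeCase.

(** * From prime moduli to all moduli, and to Kneser hypergraphs *)

Lemma zero_sum_property_prime p : prime p -> zero_sum_property 'F_p.
Proof.
move=> p_pr E F B c defB.
have [A A_zs|no_zs] := pickP (zero_sum_family (I := 'F_p) F B c).
  by exists A.
by case: (@prime_case_absurd p E F B c p_pr _ defB) => A; rewrite no_zs.
Qed.

Lemma zero_sum_property_ord n : (1 < n)%N -> zero_sum_property 'I_n.
Proof.
elim/ltn_ind: n => n IHn n_gt1; have [n_pr|] := boolP (prime n).
  apply: zero_sum_property_card (zero_sum_property_prime n_pr).
  by rewrite card_Fp // card_ord.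
case/primePn=> [|[d /andP[d_gt1 d_lt] /dvdnP[q def_n]]]; first by lia.
have [q_gt1 q_lt] : (1 < q /\ q < n)%N by split; nia.
apply: zero_sum_property_card (zero_sum_property_prod (IHn q _ _) (IHn d _ _)) => //.
by rewrite card_prod !card_ord.
Qed.

Close Scope ring_scope.

Theorem theorem1p3 (n m : nat) (hn : 2 <= n) (F : {set {set 'I_m}})
    (hcd : 2 * n - 1 <= cd n F) (c : kneser_vertex F -> 'Z_n) :
  exists A : 'I_n -> kneser_vertex F,
    kneser_hyperedge A /\ (\sum_(i < n) c (A i) = 0)%R.
Proof.
(* Colours become natural representatives, extended by 0 outside [F]. *)
pose c0 (X : {set 'I_m}) : nat := if insub X is Some v then c v else 0.
have [|W /and3P[Wd /forallP WF Wc]] := @zero_sum_property_ord n hn _ F setT c0.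
  apply/forallP=> A; apply/implyP=> /avoiding_familyP[Ad _ AF].
  (* As [2 * n - 1] is positive, [2 * n - 1 <= m - M] amounts to [M + 2 * n <= m.+1], which is
     defectiveness of the whole ground set. *)
  rewrite cardsT !card_ord; move: hcd; rewrite /cd; set M := bigop _ _ _.
  suff : \sum_i #|A i| <= M by lia.
  apply: (@leq_bigmax_cond _ _ (fun A : {ffun 'I_n -> {set 'I_m}} => \sum_i #|A i|)).
  by apply/andP; split=> //; apply/forallP=> i; apply/forall_inP; apply: AF.
have WF' i : W i \in F by have /andP[] := WF i.
exists (fun i => Sub (W i) (WF' i)); split; first exact: Wd.
have cE i : c (Sub (W i) (WF' i)) = (c0 (W i))%:R%R.
  by rewrite /c0 (insubT (fun X => X \in F) (WF' i)) natr_Zp.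
under eq_bigr => i _ do rewrite cE.
rewrite -natr_sum; move: Wc; rewrite card_ord => /dvdnP[q ->].
by rewrite natrM pchar_Zp // mulr0.
Qed.
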